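(* Let $\Gamma$ be a finitely generated abelian group equipped with an injective endomorphism $F$ such that, for every integer $\delta>0$, $F^{\delta}-1$ is not a zero divisor in the subring of $\operatorname{End}(\Gamma)$ generated by $F$, and such that $\Gamma$ has an $F^r$-spanning set for some integer $r>0$. Then every $F$-subset of $\Gamma$ is $F$-normal.
   Context: Let $\Gamma$ be a finitely generated abelian group and $F$ an endomorphism of $\Gamma$. $F$-subsets: an $F$-subset of $\Gamma$ is a finite union of finite set sums ($A+B=\{a+b: a\in A,b\in B\}$) of: singletons in $\Gamma$; $F$-invariant subgroups $H\le\Gamma$ (i.e. $F(H)\subseteq H$); and $F$-cycles, i.e. sets $C(\gamma;\delta):=\{\gamma+F^\delta\gamma+F^{2\delta}\gamma+\cdots+F^{\ell\delta}\gamma:\ell\in\mathbb N\}$ with $\gamma\in\Gamma$, $\delta$ a positive integer ($0\in\mathbb N$). $F$-spanning sets: for a finite word $x_0x_1\cdots x_m$ with letters in $\Gamma$ put $[x_0x_1\cdots x_m]_F:=x_0+Fx_1+\cdots+F^mx_m$, and $[\emptyset]_F:=0$ for the empty word. A finite subset $\Sigma\subseteq\Gamma$ is an $F$-spanning set for $\Gamma$ if: (i) $0\in\Sigma$ and $x\in\Sigma\Rightarrow -x\in\Sigma$; (ii) for $x\in\Gamma$, $Fx\in\Sigma\Rightarrow x\in\Sigma$; (iii) every $x\in\Gamma$ equals $[x_0\cdots x_m]_F$ for some $m\ge 0$ and $x_0,\dots,x_m\in\Sigma$; (iv) for all $x_1,\dots,x_5\in\Sigma$ there are $t,t'\in\Sigma$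 with $x_1+\cdots+x_5=t+Ft'$; (v) if $x_1,x_2,x_3\in\Sigma$ and $x_1+x_2+x_3\in F(\Gamma)$ then there is $t\in\Sigma$ with $x_1+x_2+x_3=Ft$. The notions of $F^r$-spanning set and $[w]_{F^r}$ are obtained by replacing $F$ by $F^r$. $\Sigma^*$ denotes the set of finite words on $\Sigma$. $F$-normality: a language $\mathcal L\subseteq\Sigma^*$ (with $\Sigma$ a finite alphabet) is sparse if it is regular and $\#\{w\in\mathcal L:\operatorname{length}(w)\le n\}=O(n^d)$ for some natural number $d$. A subset $S\subseteq\Gamma$ is $F$-sparse if $S=\{[w]_{F^r}:w\in\mathcal L\}$ for some $r>0$, some $F^r$-spanning set $\Sigma$ for $\Gamma$, and some sparse language $\mathcal L\subseteq\Sigma^*$. A subset of $\Gamma$ is $F$-normal if, up to a finite symmetric difference, it is a finite union of sets of the form $\gamma+T+H$ where $\gamma\in\Gamma$, $T$ is $F$-sparse, and $H$ is an $F$-invariant subgroup of $\Gamma$. *)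

(* Defs.v *)
From HB Require Import structures.
From mathcomp Require Import all_boot all_order all_algebra finmap.
From mathcomp Require Import all_classical.

Set Implicit Arguments.
Unset Strict Implicit.
Unset Printing Implicit Defensive.

Import GRing.Theory.
Local Open Scope classical_set_scope.
Local Open Scope ring_scope.

Section Groups.
Variable G : zmodType.
Implicit Types (F : G -> G) (A B S H : set G).

Definition finitely_generated : Prop :=
  exists (m : nat) (s : m.-tuple G), forall x : G, inIntSpan s x.

(* The ring End(G) has multiplication [\o] and unit [id].  [endo_subring] is
   stated for sets of self-maps of G: since {additive G -> G} is itself such a
   set, the least one containing an additive F consists of additive maps and is
   the subring of End(G) generated by F. *)
Definition endo_subring (R : set (G -> G)) : Prop :=
  [/\ R id,
      forall f g, R f -> R g -> R (f - g)
    & forall f g, R f -> R g -> R (f \o g)].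

Definition generated_subring F : set (G -> G) := smallest endo_subring [set F].

(* With this convention 0 is a zero divisor of every nontrivial ring. *)
Definition zero_divisor (R : set (G -> G)) (f : G -> G) : Prop :=
  exists g : G -> G, [/\ R g, g <> 0 & f \o g = 0 \/ g \o f = 0].

Definition set_add A B : set G := [set a + b | a in A & b in B].

Definition finite_union (P : set G -> Prop) S : Prop :=
  exists (n : nat) (A : 'I_n -> set G),
    (forall i, P (A i)) /\ S = \bigcup_i A i.

Definition finite_set_sum (P : set G -> Prop) S : Prop :=
  exists (n : nat) (A : 'I_n -> set G),
    (forall i, P (A i)) /\ S = \big[set_add/[set 0]]_(i < n) A i.

Definition subgroup H : Prop := H 0 /\ forall x y, H x -> H y -> H (x - y).

Definition invariant_subgroup F H : Prop := subgroup H /\ F @` H `<=` H.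

Definition Fcycle F (x : G) (d : nat) : set G :=
  [set \sum_(i < l.+1) iter (i * d) F x | l in [set: nat]].

Definition basic_Fset F A : Prop :=
  [\/ exists x : G, A = [set x],
      invariant_subgroup F A
    | exists (x : G) (d : nat), (0 < d)%N /\ A = Fcycle F x d].

Definition Fsubset F S : Prop := finite_union (finite_set_sum (basic_Fset F)) S.

Definition word_value F (w : seq G) : G := \sum_(i < size w) iter i F w`_i.

Definition spanning_set F (Sigma : {fset G}) : Prop :=
  (0 \in Sigma /\ (forall x, x \in Sigma -> - x \in Sigma)) /\
  [/\ forall x, F x \in Sigma -> x \in Sigma,
      forall x, exists w : seq G,
        [/\ w != [::], {subset w <= Sigma} & x = word_value F w],
      forall x1 x2 x3 x4 x5,
        x1 \in Sigma -> x2 \in Sigma -> x3 \in Sigma -> x4 \in Sigma ->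
        x5 \in Sigma ->
        exists t t', [/\ t \in Sigma, t' \in Sigma &
                         x1 + x2 + x3 + x4 + x5 = t + F t']
    & forall x1 x2 x3,
        x1 \in Sigma -> x2 \in Sigma -> x3 \in Sigma ->
        range F (x1 + x2 + x3) ->
        exists t, t \in Sigma /\ x1 + x2 + x3 = F t].

End Groups.

Record dfa (A : finType) := Dfa {
  dfa_state : finType;
  dfa_start : dfa_state;
  dfa_final : pred dfa_state;
  dfa_step : dfa_state -> A -> dfa_state }.

Definition dfa_language (A : finType) (M : dfa A) : set (seq A) :=
  [set w | dfa_final (foldl (@dfa_step A M) (dfa_start M) w)].

Definition regular (A : finType) (L : set (seq A)) : Prop :=
  exists M : dfa A, L = dfa_language M.

(* [X #<= `I_k] says that X has at most k elements. *)
Definition sparse (A : finType) (L : set (seq A)) : Prop :=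
  regular L /\
  exists d C n0 : nat, forall n : nat, (n0 <= n)%N ->
    ([set w | L w /\ (size w <= n)%N] #<= `I_(C * n ^ d))%card.

Section Normality.
Variable G : zmodType.
Implicit Types (F : G -> G) (S T H : set G).

Definition Fsparse F S : Prop :=
  exists (r : nat) (Sigma : {fset G}) (L : set (seq Sigma)),
    [/\ (0 < r)%N, spanning_set (iter r F) Sigma, sparse L &
        S = [set word_value (iter r F) (map val w) | w in L]].

Definition basic_Fnormal F S : Prop :=
  exists (x : G) (T H : set G),
    [/\ Fsparse F T, invariant_subgroup F H &
        S = set_add (set_add [set x] T) H].

Definition Fnormal F S : Prop :=
  exists S' : set G,
    finite_union (basic_Fnormal F) S' /\ finite_set (S `+` S').

End Normality.

(* Main.v *)
Require Import Defs.
From HB Require Import structures.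
From mathcomp Require Import all_boot all_order all_algebra finmap.
From mathcomp Require Import all_classical.

Local Open Scope ring_scope.

(** The theorem holds because an [F]-subset is, on the nose, a finite union of
sets [y + T + H] with [T] an [F]-sparse set and [H] an invariant subgroup; no
finite correction is made.

Invariant subgroups and singletons add up among themselves, so the question is
about sums of cycles.  A cycle of step [d] can be cut according to the residue
modulo [q] of the number of its terms: it is the union of [q] translates of
sets of partial sums [x + E x + ... + E^(n-1) x], with [E = F^(q d)] and
[n >= 0] ([Fcycle_split]).  Hence all the cycles in a given sum may be
taken to have the same step [D], a multiple of [r] and of all the original
steps, and, sums being distributive over unions, it remains to see that a sum
of sets of partial sums of the same [E = F^D] is [F]-sparse.

An element of that set is [\sum_j \sum_(i < l j) E^i (x j)].  Grouping by powers
of [E], it is the value in base [E] of the word whose [i]-th letter is the sum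
of the [x j] such that [i < l j].  These index sets decrease with [i], so the
words in question are the images of the decreasing chains of subsets of a
fixed finite set.  Such words form a regular language
([chain_language_regular]), and there are polynomially many of them of length
at most [n], since each is determined by its length and the numbers [l j]
([chain_language_sparse]).

What is left is to find an [E]-spanning set that contains the finitely many
letters [\sum_(j in B) x j], so that no carry ever occurs.  Let [Sigma] be a
spanning set for [F^r].  The set of values of the words of length [n] over
[Sigma] is a spanning set for [F^(m r)] as soon as [2 <= m <= n]
([spanning_word_values]).  Here [n] can be increased while [m] is fixed, and
these sets exhaust the group: some [n] suits any given finite set of
letters. *)

(** * Words over a spanning set *)

Section SpanningSets.
Set Implicit Arguments.
Unset Strict Implicit.
Import GRing.Theory.
Variable G : zmodType.

Lemma iter_is_zmod_morphism (E : {additive G -> G}) n :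
  zmod_morphism (iter n E).
Proof. by elim: n => [|n IHn] x y //=; rewrite IHn raddfB. Qed.

HB.instance Definition _ (E : {additive G -> G}) n :=
  GRing.isZmodMorphism.Build G G (iter n E) (iter_is_zmod_morphism E n).

Lemma word_value_cons (E : {additive G -> G}) a w :
  word_value E (a :: w) = a + E (word_value E w).
Proof.
by rewrite /word_value /= big_ord_recl /= raddf_sum.
Qed.

Lemma iter_injective (T : Type) (f : T -> T) n :
  injective f -> injective (iter n f).
Proof. by move=> f_inj; elim: n => [|n IHn] x y //= /f_inj /IHn. Qed.

Variables (E : {additive G -> G}) (Sigma : {fset G}).

(** When [0] is in [Sigma], words can be padded with zeros and only an upper
bound on their length matters: these sets increase with [n]. *)
Fixpoint word_values n : {fset G} :=
  if n is k.+1 then [fset (x + E y)%R | x in Sigma, y in word_values k]%fset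
  else [fset 0%R]%fset.

Lemma word_valuesS n x y :
  x \in Sigma -> y \in word_values n -> x + E y \in word_values n.+1.
Proof. by move=> xS yn; apply/imfset2P; exists x => //; exists y. Qed.

Lemma word_valuesSP n z : z \in word_values n.+1 ->
  exists x y, [/\ x \in Sigma, y \in word_values n & z = x + E y].
Proof. by move=> /imfset2P[x xS [y yn ->]]; exists x, y. Qed.

Lemma word_valuesD m n z : z \in word_values (m + n) ->
  exists x y, [/\ x \in word_values m, y \in word_values n
                & z = x + iter m E y].
Proof.
elim: m z => [|m IHm] z /= zmn.
  by exists 0, z; rewrite add0r inE.
have [a [u [aS /IHm[x [y [xm yn ->]]] ->]]] := word_valuesSP zmn.
exists (a + E x), y; split=> //; first exact: word_valuesS.
by rewrite raddfD addrA.
Qed.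

Lemma word_value_mem w :
  {subset w <= Sigma} -> word_value E w \in word_values (size w).
Proof.
elim: w => [|a w IHw] wS; first by rewrite /word_value /= big_ord0 inE.
rewrite word_value_cons; apply: word_valuesS.
  by apply: wS; rewrite mem_head.
by apply: IHw => x xw; apply: wS; rewrite in_cons xw orbT.
Qed.

Hypothesis E_inj : injective E.
Hypothesis Sspan : spanning_set E Sigma.

Let S0 : 0 \in Sigma. Proof. by case: Sspan => -[]. Qed.
Let SN x : x \in Sigma -> - x \in Sigma. Proof. by case: Sspan => -[_ +] _; apply. Qed.

Lemma word_values_leq m n x :
  (m <= n)%N -> x \in word_values m -> x \in word_values n.
Proof.
elim: n m x => [|n IHn] [|m] x //=.
  rewrite inE => _ /eqP->; rewrite -[0]add0r -{2}(raddf0 E).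
  by apply: word_valuesS => //; apply: (IHn 0%N) => //; rewrite inE.
rewrite ltnS => mn /word_valuesSP[a [y [aS ym ->]]].
by apply: word_valuesS => //; apply: IHn ym.
Qed.

Lemma word_values0 n : 0 \in word_values n.
Proof. by apply: (@word_values_leq 0) => //; rewrite inE. Qed.

Lemma spanning_in_word_values n x : x \in Sigma -> x \in word_values n.+1.
Proof.
move=> xS; rewrite -[x]addr0 -(raddf0 E).
by apply: word_valuesS => //; apply: word_values0.
Qed.

Lemma word_valuesN n x : x \in word_values n -> - x \in word_values n.
Proof.
elim: n x => [|n IHn] x /=.
  by rewrite !inE => /eqP->; rewrite oppr0.
move=> /word_valuesSP[a [y [aS yn ->]]].
by rewrite opprD -raddfN; apply: word_valuesS; [exact: SN | exact: IHn].
Qed.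

Lemma word_values_exhaust x : exists n, x \in word_values n.
Proof.
case: Sspan => _ [_ /(_ x)[w [_ wS ->]] _ _].
by exists (size w); apply: word_value_mem.
Qed.

Lemma spanning_add5 x1 x2 x3 x4 x5 :
  x1 \in Sigma -> x2 \in Sigma -> x3 \in Sigma -> x4 \in Sigma ->
  x5 \in Sigma ->
  exists t t', [/\ t \in Sigma, t' \in Sigma & x1 + x2 + x3 + x4 + x5 = t + E t'].
Proof. by case: Sspan => _ [_ _ + _]; apply. Qed.

Lemma spanning_div3 x1 x2 x3 :
  x1 \in Sigma -> x2 \in Sigma -> x3 \in Sigma ->
  range E (x1 + x2 + x3) -> exists t, t \in Sigma /\ x1 + x2 + x3 = E t.
Proof. by case: Sspan => _ [_ _ _]; apply. Qed.

Lemma spanning_add2 x y : x \in Sigma -> y \in Sigma ->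
  exists t t', [/\ t \in Sigma, t' \in Sigma & x + y = t + E t'].
Proof.
move=> xS yS; have := spanning_add5 xS yS S0 S0 S0.
by rewrite !addr0.
Qed.

(** Addition digit by digit.  Five digits produce a digit and one carry; adding
that digit to the two incoming carries produces a digit and another carry.  So
two carries are enough for five summands, and after the last digit they
occupy two more positions. *)
Lemma word_values_add5 n x1 x2 x3 x4 x5 c d :
    x1 \in word_values n -> x2 \in word_values n -> x3 \in word_values n ->
    x4 \in word_values n -> x5 \in word_values n ->
    c \in Sigma -> d \in Sigma ->
  x1 + x2 + x3 + x4 + x5 + (c + d) \in word_values n.+2.
Proof.
elim: n x1 x2 x3 x4 x5 c d => [|n IHn] x1 x2 x3 x4 x5 c d.
  rewrite !inE => /eqP-> /eqP-> /eqP-> /eqP-> /eqP-> cS dS.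
  have [t [t' [tS t'S ->]]] := spanning_add2 cS dS.
  rewrite !add0r; apply: word_valuesS => //; exact: spanning_in_word_values.
move=> /word_valuesSP[a1 [y1 [a1S y1n ->]]] /word_valuesSP[a2 [y2 [a2S y2n ->]]].
move=> /word_valuesSP[a3 [y3 [a3S y3n ->]]] /word_valuesSP[a4 [y4 [a4S y4n ->]]].
move=> /word_valuesSP[a5 [y5 [a5S y5n ->]]] cS dS.
have [t [t' [tS t'S at']]] := spanning_add5 a1S a2S a3S a4S a5S.
have := spanning_add5 tS cS dS S0 S0; rewrite !addr0 => -[s [s' [sS s'S ts']]].
have -> : a1 + E y1 + (a2 + E y2) + (a3 + E y3) + (a4 + E y4) + (a5 + E y5)
    + (c + d) = s + E (y1 + y2 + y3 + y4 + y5 + (t' + s')).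
  rewrite (AC (2*2*2*2*2*2)
    ((1*3*5*7*9) * (2*4*6*8*10) * (11*12))) /= at'.
  rewrite (AC (2*1*2) (1*4*5*(3*2))) /= ts' !(raddfD E) /=.
  by rewrite [RHS](AC (1*(1*2)) (1*4*(2*3))).
by apply: word_valuesS => //; apply: IHn.
Qed.

(** With three summands a single carry suffices, as three digits and a carry
are at most five letters. *)
Lemma word_values_add3 n x1 x2 x3 c :
    x1 \in word_values n -> x2 \in word_values n -> x3 \in word_values n ->
    c \in Sigma ->
  x1 + x2 + x3 + c \in word_values n.+1.
Proof.
elim: n x1 x2 x3 c => [|n IHn] x1 x2 x3 c.
  rewrite !inE => /eqP-> /eqP-> /eqP-> cS.
  by rewrite !add0r; apply: spanning_in_word_values.
move=> /word_valuesSP[a1 [y1 [a1S y1n ->]]] /word_valuesSP[a2 [y2 [a2S y2n ->]]].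
move=> /word_valuesSP[a3 [y3 [a3S y3n ->]]] cS.
have := spanning_add5 a1S a2S a3S cS S0; rewrite addr0 => -[t [t' [tS t'S at']]].
have -> : a1 + E y1 + (a2 + E y2) + (a3 + E y3) + c
    = t + E (y1 + y2 + y3 + t').
  rewrite (AC (2*2*2*1) ((1*3*5*7) * (2*4*6))) /= at' !(raddfD E) /=.
  by rewrite [RHS](AC (1*2) (1*3*2)).
by apply: word_valuesS => //; apply: IHn.
Qed.

(** Division by [E] one digit at a time.  If [c + a + E y] is divisible by [E],
so is [c + a], and its quotient is again a letter: the carry goes downwards and
remains a single letter [c]. *)
Lemma word_values_div m n c x z : (m <= n)%N ->
    c \in Sigma -> x \in word_values n -> c + x = iter m E z ->
  z \in word_values (n - m).+1.
Proof.
elim: m n c x => [|m IHm] n c x mn cS xn cxz.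
  have -> : z = x + 0 + 0 + c by rewrite !addr0 addrC cxz.
  by rewrite subn0; apply: word_values_add3 => //; apply: word_values0.
case: n mn xn => // n mn /word_valuesSP[a [y [aS yn xE]]].
have caE : c + a + 0 = E (iter m E z - y).
  by rewrite raddfB -[E (iter m E z)]/(iter m.+1 E z) -cxz xE addr0 addrA addrK.
have [|t [tS cat]] := spanning_div3 cS aS S0; first by exists (iter m E z - y).
rewrite subSS; apply: (IHm n t y) => //.
have /E_inj -> : E t = E (iter m E z - y) by rewrite -cat.
by rewrite subrK.
Qed.

(** The bound [1 < m] makes room for carries: a sum of five words of length [n]
has length [n + 2], so that after its first [m] digits at most [n] remain, and
a quotient by [E^m] of a sum of three of them, having length [n + 1], has length
at most [n + 2 - m].  Regrouping digits by blocks of [m] shows that every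
element is a word in base [E^m]. *)
Lemma spanning_word_values m n : (1 < m)%N -> (m <= n)%N ->
  spanning_set (iter m E) (word_values n).
Proof.
move=> m1 mn.
have div3 x1 x2 x3 z : x1 \in word_values n -> x2 \in word_values n ->
    x3 \in word_values n -> x1 + x2 + x3 = iter m E z -> z \in word_values n.
  move=> x1n x2n x3n xz.
  have x_n1 := word_values_add3 x1n x2n x3n S0.
  have := word_values_div (leq_trans mn (leqnSn n)) S0 x_n1.
  rewrite addr0 add0r => /(_ _ xz); apply: word_values_leq.
  by rewrite subSn // -{2}(subnK mn) -addn2 leq_add2l.
split.
  split; first exact: word_values0.
  exact: word_valuesN.
split.
- move=> x xn; apply: (div3 (iter m E x) 0 0); rewrite ?word_values0 //.
  by rewrite !addr0.
- move=> x; have [N] := word_values_exhaust x.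
  have NmN : (N <= N * m)%N by rewrite leq_pmulr // ltnW.
  move=> /(word_values_leq NmN) {NmN}.
  elim: N x => [|N IHN] x.
    rewrite inE => /eqP->; exists [:: 0]; split=> //.
      by move=> y; rewrite inE => /eqP->; apply: word_values0.
    by rewrite word_value_cons [word_value _ [::]]big_ord0 raddf0 addr0.
  rewrite mulSn => /word_valuesD[u [v [um /IHN[w [w0 wn ->]] ->]]].
  exists (u :: w); split => //; last by rewrite word_value_cons.
  move=> y; rewrite inE => /orP[/eqP->|/wn//].
  exact: word_values_leq um.
- move=> x1 x2 x3 x4 x5 x1n x2n x3n x4n x5n.
  have := word_values_add5 x1n x2n x3n x4n x5n S0 S0; rewrite !addr0.
  rewrite -(subnKC (leq_trans mn (leq_trans (leqnSn n) (leqnSn n.+1)))).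
  move=> /word_valuesD[t [t' [tm t'n ->]]]; exists t, t'; split=> //.
    exact: word_values_leq tm.
  by apply: word_values_leq t'n; rewrite leq_subLR -addn2 addnC leq_add2r.
- move=> x1 x2 x3 x1n x2n x3n [z _ zx]; exists z; split=> //.
  exact: (div3 x1 x2 x3).
Qed.

End SpanningSets.

(** * The language of decreasing chains of sets *)

Section ChainLanguage.
Set Implicit Arguments.
Unset Strict Implicit.
Variables (I A : finType) (phi : {set I} -> A).
Implicit Types (l : I -> nat) (w : seq A).

(** The chain of sets is encoded by the time [l j] at which each [j] leaves. *)
Definition chain_word l n : seq A := mkseq (fun i => phi [set j | (i < l j)%N]%SET) n.

Definition chain_language : set (seq A) :=
  [set w | exists l, w = chain_word l (size w)]%classic.

(** A word does not determine the sets behind its letters, as [phi] need not be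
injective, so a state is the set of all the subsets that the chain may have
reached: this is the powerset construction.  The chain starts below the full
set. *)
Definition chain_dfa : dfa A :=
  @Dfa A {set {set I}} [set [set: I]]%SET
    (fun X => X != finset.set0)
    (fun X a => [set B | (phi B == a) && [exists C in X, B \subset C]]%SET).

Lemma chain_word_eq l l' n :
  (forall i, (minn (l i) n = minn (l' i) n)%N) -> chain_word l n = chain_word l' n.
Proof.
move=> ll'; apply/eq_in_map => i; rewrite mem_iota /= add0n => i_n.
congr phi; apply/setP => j; rewrite !inE.
by rewrite -[LHS]andbT -[RHS]andbT -i_n -!ltn_min ll'.
Qed.

(** The sets reached after reading [w] are described with [<=] rather than [<]
since [B] is the set used for the last letter; for the empty word it is the
full set. *)
Lemma mem_chain_dfa B w :
  B \in foldl (@dfa_step A chain_dfa) (dfa_start chain_dfa) w <->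
  exists l, w = chain_word l (size w) /\ B = [set j | (size w <= l j)%N]%SET.
Proof.
elim/last_ind: w B => [|w a IHw] B.
  rewrite /= inE; split=> [/eqP->|[l [_ ->]]].
    by exists (fun=> 0%N); split=> //; apply/setP => j; rewrite !inE.
  by apply/eqP/setP => j; rewrite !inE.
rewrite foldl_rcons /= inE size_rcons; split.
  move=> /andP[/eqP phiB /exists_inP[C /IHw[l [wl Cl]] BC]].
  (* The elements outside B leave now at the latest; those of B have stayed so
     far, because B is included in C, and stay for one more letter. *)
  exists (fun j => if j \in B then (size w).+1 else minn (l j) (size w)).
  have BE : B = [set j | (size w <
      (if j \in B then (size w).+1 else minn (l j) (size w)))%N]%SET.
    apply/setP => j; rewrite !inE; case: (j \in B); first by rewrite ltnSn.
    by rewrite ltnNge geq_minr.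
  split=> //; rewrite /chain_word mkseqS -BE phiB {1}wl; congr rcons.
  apply: chain_word_eq => j; case: ifP => [/(fintype.subsetP BC)|_].
    rewrite Cl inE => /minn_idPr->; symmetry; apply/minn_idPr; exact: leqnSn.
  by rewrite -minnA minnn.
move=> [l []]; rewrite /chain_word mkseqS => /rcons_inj[wl al] BE.
rewrite BE al eqxx /=; apply/exists_inP; exists [set j | (size w <= l j)%N]%SET.
  by apply/IHw; exists l.
by apply/fintype.subsetP => j; rewrite !inE; apply: ltnW.
Qed.

Lemma chain_language_regular : regular chain_language.
Proof.
exists chain_dfa; apply/seteqP; split=> w /=.
  move=> [l wl]; apply/set0Pn; exists [set j | (size w <= l j)%N]%SET.
  by apply/mem_chain_dfa; exists l.
by move=> /set0Pn[B /mem_chain_dfa[l [wl _]]]; exists l.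
Qed.

(** A word of length at most [n] is determined by its length and the leaving
times truncated at [n], that is, by [#|I|.+1] numbers which are at most [n]. *)
Lemma chain_language_sparse : sparse chain_language.
Proof.
split; first exact: chain_language_regular.
exists #|I|.+1, (2 ^ #|I|.+1)%N, 1%N => n n_gt0.
pose T : finType := ('I_n.+1 * {ffun I -> 'I_n.+1})%type.
pose f (x : T) := chain_word (fun i => x.2 i) x.1.
have Tn : (#|{: T}| <= 2 ^ #|I|.+1 * n ^ #|I|.+1)%N.
  (* n + 1 <= 2 n *)
  rewrite card_prod card_ffun card_ord -expnS -expnMn leq_exp2r //.
  by rewrite mul2n -addnn -addn1 leq_add2l.
apply: (@card_le_trans _ _ _ (range (f \o @enum_val T predT))).
  apply: subset_card_le => w [[l wl] wn].
  exists (enum_rank (inord (size w), [ffun i => inord (minn (l i) n)])) => //.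
  rewrite /f /= enum_rankK /= inordK // [RHS]wl; apply: chain_word_eq => i.
  rewrite ffunE inordK ?ltnS ?geq_minr // -minnA; congr minn.
  exact/minn_idPr.
apply: card_le_trans (card_image_le _ _) _.
by rewrite -(card_le_eql card_II) card_le_II.
Qed.

End ChainLanguage.

(** * Sums and finite unions of sets *)

Section SetAdd.
Set Implicit Arguments.
Unset Strict Implicit.
Import GRing.Theory.
Local Open Scope classical_set_scope.
Variable G : zmodType.
Implicit Types A B C : set G.

Lemma set_addA : associative (@set_add G).
Proof.
move=> A B C; apply/seteqP; split=> z.
  move=> [a Aa [_ [b Bb [c Cc <-]] <-]]; rewrite addrA.
  by exists (a + b); [exists a => //; exists b | exists c].
move=> [_ [a Aa [b Bb <-]] [c Cc <-]]; rewrite -addrA.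
by exists a => //; exists (b + c) => //; exists b => //; exists c.
Qed.

Lemma set_addC : commutative (@set_add G).
Proof.
move=> A B; apply/seteqP; split=> z [a Aa [b Bb <-]]; rewrite addrC;
  by exists b => //; exists a.
Qed.

Lemma set_add0 : left_id [set 0] (@set_add G).
Proof.
move=> A; apply/seteqP; split=> z; first by move=> [_ -> [a Aa <-]]; rewrite add0r.
by move=> Az; exists 0 => //; exists z => //; rewrite add0r.
Qed.

HB.instance Definition _ :=
  Monoid.isComLaw.Build (set G) [set 0] (@set_add G) set_addA set_addC set_add0.

Lemma set_add1 (x y : G) : set_add [set x] [set y] = [set x + y].
Proof.
apply/seteqP; split=> z; first by move=> [_ -> [_ -> <-]].
by move=> ->; exists x => //; exists y.
Qed.

Lemma mem_big_set_add (I : finType) (A : I -> set G) x :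
  (\big[@set_add G/[set 0]]_i A i) x <->
  exists2 f : I -> G, (forall i, A i (f i)) & x = \sum_i f i.
Proof.
split=> [|[f Af ->]]; last first.
  elim/big_rec2: _ => [//|i X y _ Xy].
  by exists (f i) => //; exists X.
move=> xA; suff [f Af ->] : exists2 f : I -> G,
    (forall i, i \in index_enum I -> A i (f i)) & x = \sum_i f i.
  by exists f => // i; apply: Af; rewrite mem_index_enum.
elim: (index_enum I) (index_enum_uniq I) x xA => [_ x|i r IHr /= /andP[ir r_uniq] x].
  by rewrite big_nil => ->; exists (fun=> 0); rewrite ?big_nil.
rewrite big_cons => -[a Aa [b /(IHr r_uniq)[f Af bE] <-]].
exists (fun j => if j == i then a else f j) => [j|].
  by rewrite inE; case: eqVneq => [-> //|_ /= /Af].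
rewrite big_cons eqxx bE; congr (_ + _).
apply: eq_big_seq => j jr; case: eqVneq => // ji.
by rewrite -ji jr in ir.
Qed.

Lemma finite_unionP (P : set G -> Prop) (T : finType) (A : T -> set G) :
  (forall t, P (A t)) -> finite_union P (\bigcup_t A t).
Proof.
move=> PA; exists #|T|, (A \o enum_val); split=> [i|]; first exact: PA.
apply/seteqP; split=> x [t _ At]; last by exists (enum_val t).
by exists (enum_rank t) => //=; rewrite enum_rankK.
Qed.

Lemma finite_union1 (P : set G -> Prop) A : P A -> finite_union P A.
Proof.
move=> PA; have := @finite_unionP P unit (fun=> A) (fun=> PA).
congr finite_union; apply/seteqP; split=> x; first by move=> [].
by exists tt.
Qed.

Lemma finite_union_add (P : set G -> Prop) :
    (forall A B, P A -> P B -> P (set_add A B)) ->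
  forall A B, finite_union P A -> finite_union P B -> finite_union P (set_add A B).
Proof.
move=> PD _ _ [m [A [PA ->]]] [n [B [PB ->]]].
have := @finite_unionP P ('I_m * 'I_n)%type (fun t => set_add (A t.1) (B t.2))
  (fun t => PD _ _ (PA t.1) (PB t.2)).
congr finite_union; apply/seteqP; split=> x.
  by move=> [[i j] _ [a Aa [b Bb <-]]]; exists a; [exists i | exists b => //; exists j].
by move=> [a [i _ Aa] [b [j _ Bb] <-]]; exists (i, j) => //; exists a => //; exists b.
Qed.

Lemma finite_union_join (P Q : set G -> Prop) S :
  (forall A, Q A -> finite_union P A) -> finite_union Q S -> finite_union P S.
Proof.
move=> QP [n [A [QA ->]]].
have /choice[k Ak] : forall i, exists k (B : 'I_k -> set G),
    (forall j, P (B j)) /\ A i = \bigcup_j B j.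
  by move=> i; apply: QP.
pose B i := projT1 (cid (Ak i)); have AB i := projT2 (cid (Ak i)).
have := @finite_unionP P {i : 'I_n & 'I_(k i)} (fun t => B (tag t) (tagged t))
  (fun t => (AB (tag t)).1 (tagged t)).
congr finite_union; apply/seteqP; split=> x.
  by move=> [[i j] _ Bx]; exists i => //; rewrite (AB i).2; exists j.
by move=> [i _]; rewrite (AB i).2 => -[j _ Bx]; exists (Tagged (fun i => 'I_(k i)) j).
Qed.

Lemma invariant_subgroup_add (F : {additive G -> G}) H K :
    invariant_subgroup F H -> invariant_subgroup F K ->
  invariant_subgroup F (set_add H K).
Proof.
move=> [[H0 HB] HF] [[K0 KB] KF].
split; first split.
- by exists 0 => //; exists 0 => //; rewrite addr0.
- move=> _ _ [a Ha [b Kb <-]] [c Hc [d Kd <-]].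
  exists (a - c); first exact: HB.
  by exists (b - d); [exact: KB | rewrite opprD addrACA].
- move=> _ [_ [a Ha [b Kb <-]] <-]; rewrite raddfD.
  by exists (F a); [apply: HF; exists a | exists (F b) => //; apply: KF; exists b].
Qed.

Lemma invariant_subgroup0 (F : {additive G -> G}) : invariant_subgroup F [set 0].
Proof.
split; first by split=> // x y -> ->; rewrite subrr.
by move=> _ [_ -> <-]; rewrite raddf0.
Qed.

End SetAdd.

(** * Truncated cycles *)

Section Cycles.
Set Implicit Arguments.
Unset Strict Implicit.
Import GRing.Theory.
Local Open Scope classical_set_scope.
Variable G : zmodType.
Implicit Types (E F : {additive G -> G}) (I : finType).

(** Unlike in a cycle, the empty sum is included; a cycle is a translate of
such a set, and its splitting below has no exceptional short sums. *)
Definition partial_sums (E : G -> G) x : set G :=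
  [set \sum_(i < n) iter i E x | n in [set: nat]].

(** Euclidean division of the number [l] by [q]: the terms after the first
[l %% q + 1] are grouped by blocks of [q], and each block is the image of the
previous one by [F^(q d)]. *)
Lemma Fcycle_split F x d q : (0 < q)%N ->
  Fcycle F x d = \bigcup_(s : 'I_q)
    set_add [set \sum_(i < s.+1) iter (i * d) F x]
      (partial_sums (iter (q * d) F) (\sum_(i < q) iter ((s.+1 + i) * d) F x)).
Proof.
move=> q_gt0.
have sumE (s a : nat) : \sum_(i < s.+1 + a * q) iter (i * d) F x =
    \sum_(i < s.+1) iter (i * d) F x +
    \sum_(i < a) iter i (iter (q * d) F)
      (\sum_(i < q) iter ((s.+1 + i) * d) F x).
  elim: a => [|a IHa]; first by rewrite mul0n addn0 big_ord0 addr0.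
  rewrite mulSnr addnA big_split_ord /= IHa [X in _ = _ + X]big_ord_recr /= addrA; congr (_ + _).
  rewrite -iterM raddf_sum; apply: eq_bigr => i _.
  by rewrite /= -iterD; congr (iter _ F x); rewrite mulnA -mulnDl addnA [(a * q + _)%N]addnC.
apply/seteqP; split=> z.
  move=> [l _ <-]; exists (Ordinal (ltn_pmod l q_gt0)) => //=.
  eexists; first by []; exists (\sum_(i < (l %/ q)%N) iter i (iter (q * d) F)
      (\sum_(i < q) iter (((l %% q)%N.+1 + i) * d) F x)); first by exists (l %/ q)%N.
  by rewrite -sumE addSn addnC -divn_eq.
move=> [s _ [_ -> [_ [a _ <-] <-]]].
by exists (s + a * q)%N => //; rewrite -addSn sumE.
Qed.

Section ChainValues.
Variables (E : {additive G -> G}) (I A : finType) (x : I -> G).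
Variables (phi : {set I} -> A) (val : A -> G).
Hypothesis val_phi : forall B : {set I}, val (phi B) = \sum_(j in B) x j.

(** Exchanging the sum over the positions with the sum over the indices. *)
Lemma chain_word_value (l : I -> nat) n :
  word_value E (map val (chain_word phi l n)) =
    \sum_j \sum_(i < minn (l j) n) iter i E (x j).
Proof.
rewrite /word_value size_map size_mkseq.
transitivity (\sum_(i < n) \sum_j if (i < l j)%N then iter i E (x j) else 0).
  apply: eq_bigr => i _; rewrite -map_comp (nth_map 0%N) ?size_iota //.
  rewrite nth_iota //= val_phi raddf_sum big_mkcond /=.
  by apply: eq_bigr => j _; rewrite inE.
rewrite exchange_big; apply: eq_bigr => j _ /=.
rewrite (big_ord_widen n (fun i => iter i E (x j)) (geq_minr _ _)) -big_mkcond.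
by apply: eq_bigl => i; rewrite ltn_min ltn_ord andbT.
Qed.

Lemma sum_partial_sums :
  \big[@set_add G/[set 0]]_j partial_sums E (x j) =
    [set word_value E (map val w) | w in chain_language phi].
Proof.
apply/seteqP; split=> z.
  move=> /mem_big_set_add[f xf ->].
  have /choice[l fl] : forall j, exists n, f j = \sum_(i < n) iter i E (x j).
    by move=> j; have [n _ <-] := xf j; exists n.
  (* A word long enough to truncate none of the sums. *)
  exists (chain_word phi l (\max_j l j)).
    by exists l; rewrite size_mkseq.
  rewrite chain_word_value; apply: eq_bigr => j _; rewrite fl.
  by rewrite (minn_idPl (leq_bigmax j)).
move=> [w [l ->] <-]; rewrite chain_word_value; apply/mem_big_set_add.
by eexists; last reflexivity; move=> j; exists (minn (l j) (size w)).
Qed.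

End ChainValues.

(** The sums of basic [F]-sets in which all the cycles have the same step [d].
The index type varies so that adding two such sets is taking a sum type. *)
Definition periodic_Fset F d (S : set G) :=
  exists (I : finType) (y : G) (x : I -> G) (H : set G),
    invariant_subgroup F H /\
    S = set_add (set_add [set y]
      (\big[@set_add G/[set 0]]_i partial_sums (iter d F) (x i))) H.

Lemma periodic_Fset_add F d A B :
  periodic_Fset F d A -> periodic_Fset F d B -> periodic_Fset F d (set_add A B).
Proof.
move=> [I [y [x [H [FH ->]]]]] [J [z [t [K [FK ->]]]]].
exists (I + J)%type, (y + z), (fun k => match k with inl i => x i | inr j => t j end),
  (set_add H K).
split; first exact: invariant_subgroup_add FH FK.
rewrite big_sumType /= -set_add1.
by rewrite [LHS](AC (3*3) ((1*4)*(2*5)*(3*6))).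
Qed.

Lemma periodic_Fset1 F d x : periodic_Fset F d [set x].
Proof.
exists void, x, (fun=> 0), [set 0]; split; first exact: invariant_subgroup0.
by rewrite big_pred0 ?set_add1 ?addr0 // => -[].
Qed.

(** The step [D] is left free among the multiples of [d], so that a common one
can be chosen for all the terms of a sum. *)
Lemma basic_Fset_periodic F A : basic_Fset F A ->
  exists2 d, (0 < d)%N & forall D, (0 < D)%N -> (d %| D)%N ->
    finite_union (periodic_Fset F D) A.
Proof.
case=> [[x ->]|FA|[x [d [d_gt0 ->]]]].
- by exists 1%N => // D _ _; apply: finite_union1; apply: periodic_Fset1.
- exists 1%N => // D _ _; apply: finite_union1.
  exists void, 0, (fun=> 0), A; split=> //.
  by rewrite big_pred0 ?set_add1 ?addr0 ?set_add0 // => -[].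
exists d => // D + /dvdnP[q Dq]; rewrite {D}Dq muln_gt0 => /andP[q_gt0 _].
rewrite (@Fcycle_split F x d q) //; apply: finite_unionP => s.
set y := (\sum_(i < s.+1) _); set t := (\sum_(i < q) _).
exists unit, y, (fun=> t), [set 0]; split; first exact: invariant_subgroup0.
rewrite [RHS]set_addC set_add0 (big_pred1 tt) // => -[]//.
Qed.

Lemma Fset_sum_periodic F r A : (0 < r)%N -> finite_set_sum (basic_Fset F) A ->
  exists2 m, (1 < m)%N & finite_union (periodic_Fset F (m * r)) A.
Proof.
move=> r_gt0 [n [B [FB ->]]].
have /choice[d Bd] : forall i : 'I_n, exists d, (0 < d)%N /\ forall D, (0 < D)%N -> (d %| D)%N ->
    finite_union (periodic_Fset F D) (B i).
  by move=> i; have [d] := basic_Fset_periodic (FB i); exists d.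
have [p p_gt0 dp] : exists2 p, (0 < p)%N & forall i, (d i %| p)%N.
  exists (\prod_i d i)%N => [|i]; first by apply: prodn_gt0 => i; case: (Bd i).
  by rewrite (bigD1 i) //= dvdn_mulr.
(* The factor 2 ensures that m > 1 even when all the steps are 1. *)
exists (2 * p)%N; first exact: leq_pmulr.
elim/big_ind: _ => [||i _].
- by apply: finite_union1; apply: periodic_Fset1.
- by apply: finite_union_add => ? ?; apply: periodic_Fset_add.
- apply: (Bd i).2; first by rewrite !muln_gt0 p_gt0.
  by rewrite dvdn_mulr // dvdn_mull.
Qed.

End Cycles.

(** * Normality *)

Section Normality.
Set Implicit Arguments.
Unset Strict Implicit.
Import GRing.Theory.
Local Open Scope classical_set_scope.
Variable G : zmodType.

(** A large enough [n] makes every sum of a subfamily of [x] a letter of the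
spanning set [word_values E Sigma n], while the base [E^m] is unchanged. *)
Lemma sum_partial_sums_sparse (E : {additive G -> G}) (Sigma : {fset G}) m
    (I : finType) (x : I -> G) :
  injective E -> spanning_set E Sigma -> (1 < m)%N ->
  exists (Sigma' : {fset G}) (L : set (seq Sigma')),
    [/\ spanning_set (iter m E) Sigma', sparse L &
        \big[@set_add G/[set 0]]_i partial_sums (iter m E) (x i) =
          [set word_value (iter m E) (map val w) | w in L]].
Proof.
move=> E_inj Sspan m_gt1.
have /choice[k xk] : forall B : {set I}, exists k,
    \sum_(j in B) x j \in word_values E Sigma k.
  by move=> B; apply: word_values_exhaust.
pose n := maxn m (\max_B k B).
have xn (B : {set I}) : \sum_(j in B) x j \in word_values E Sigma n.
  apply: (word_values_leq Sspan) (xk B).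
  exact: leq_trans (leq_bigmax B) (leq_maxr _ _).
pose phi (B : {set I}) : word_values E Sigma n := [` xn B]%fset.
exists (word_values E Sigma n), (chain_language phi); split.
- by apply: spanning_word_values; rewrite ?leq_maxl.
- exact: chain_language_sparse.
- exact: sum_partial_sums.
Qed.

Lemma periodic_Fset_normal (F : {additive G -> G}) r m (Sigma : {fset G}) S :
    injective F -> (0 < r)%N -> spanning_set (iter r F) Sigma -> (1 < m)%N ->
  periodic_Fset F (m * r) S -> basic_Fnormal F S.
Proof.
move=> F_inj r_gt0 Sspan m_gt1 [I [y [x [H [FH ->]]]]].
exists y, (\big[@set_add G/[set 0]]_i partial_sums (iter (m * r) F) (x i)), H.
split=> //.
have iterE : iter (m * r) F = iter m (iter r F) by apply/funext => z; rewrite iterM.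
have [Sigma' [L [Sspan' sL TE]]] :=
  sum_partial_sums_sparse x (iter_injective F_inj) Sspan m_gt1.
exists (m * r)%N, Sigma', L; rewrite iterE; split=> //.
by rewrite muln_gt0 r_gt0 ltnW.
Qed.

End Normality.

Theorem theorem7p4 (G : zmodType) (F : {additive G -> G})
    (fgG : finitely_generated G)
    (injF : injective F)
    (regF : forall d : nat, (0 < d)%N ->
      ~ zero_divisor (generated_subring F) (iter d F - id))
    (spanF : exists (r : nat) (Sigma : {fset G}),
      (0 < r)%N /\ spanning_set (iter r F) Sigma)
    (S : set G) (FS : Fsubset F S) :
  Fnormal F S.
Proof.
have [r [Sigma [r_gt0 Sspan]]] := spanF.
exists S; split; last by rewrite setYK; apply: finite_set0.
apply: finite_union_join FS => A /(Fset_sum_periodic r_gt0)[m m_gt1].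
apply: finite_union_join => B mB.
by apply: finite_union1; apply: (periodic_Fset_normal injF r_gt0 Sspan m_gt1).
Qed.
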